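(* Let $\varepsilon>0$, $\delta\in(0,1)$, $\Delta_0$ a positive integer, $\beta\ge0$ and $d_{max}\in(1,\Delta_0]$. Fix user sets $\{(u,S_u)\}_{u\in[n]}$, each of size at most $\Delta_0$ (the degree-capped sets), with union $\mathcal{U}$. Let $U$ be the set output by the weight-and-threshold procedure using the $\texttt{Basic}$ weighting, and $U^*$ the set output by the same procedure (same $\sigma$ and $\rho$) using the unbiased $\texttt{MAD}$ weighting with adaptive threshold $\tau=\rho+\beta\sigma$ and maximum adaptive degree $d_{max}$; probabilities are over the Gaussian noise. Then for every item $i\in\mathcal{U}$: if $\Pr(i\in U)<\Phi(\beta)$ then $\Pr(i\in U^* )\ge\Pr(i\in U)$; otherwise $\Pr(i\in U^* )\ge\Phi(\beta)$.
   Context: $\Phi$ is the standard Gaussian CDF. Weight-and-threshold procedure: choose $\sigma>0$ with $\Phi\left(\frac{1}{2\sigma}-\varepsilon\sigma\right)-e^{\varepsilon}\Phi\left(-\frac{1}{2\sigma}-\varepsilon\sigma\right)\le\delta/2$; set $\rho=\max_{t\in[\Delta_0]}\left(\frac1{\sqrt t}+\sigma\Phi^{-1}((1-\delta/2)^{1/t})\right)$; compute weights $w:\mathcal{U}\to\mathbb{R}$; add independent $\mathcal{N}(0,\sigma^2)$ noise to each coordinate to get $\tilde w$; output $\{i\in\mathcal{U}:\tilde w(i)\ge\rho\}$. $\texttt{Basic}$ weighting: $w(i)=\sum_{u:i\in S_u}1/\sqrt{|S_u|}$. Unbiased $\texttt{MAD}$ weighting (threshold $\tau$, max adaptive degree $d_{max}$):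 $\alpha=1-\frac1{2\sqrt{d_{max}}}$, $I_{adapt}=\{u:1\le|S_u|\le d_{max}\}$; for $i\in\mathcal{U}$, $w_{init}(i)=\sum_{u\in I_{adapt}:i\in S_u}1/|S_u|$, $r(i)=\max\{0,(w_{init}(i)-\tau)/w_{init}(i)\}$ ($0$ if $w_{init}(i)=0$), $w_{trunc}(i)=\min\{w_{init}(i),\tau\}$; for $u\in I_{adapt}$, $e_u=\frac1{|S_u|}\sum_{i\in S_u}r(i)$; $w_{reroute}(i)=\sum_{u\in I_{adapt}:i\in S_u}\alpha e_u/d_{max}$; output $w^*(i)=w_{trunc}(i)+w_{reroute}(i)+\sum_{u\in I_{adapt}:i\in S_u}\left(\frac1{\sqrt{|S_u|}}-\frac1{|S_u|}\right)+\sum_{u\notin I_{adapt}:i\in S_u}\frac1{\sqrt{|S_u|}}$. *)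

(* Defs.v *)
From HB Require Import structures.
From mathcomp Require Import all_boot all_order all_algebra finmap.
From mathcomp Require Import all_classical all_reals all_analysis.

Set Implicit Arguments.
Unset Strict Implicit.
Unset Printing Implicit Defensive.

Import Order.TTheory GRing.Theory Num.Theory.

Local Open Scope classical_set_scope.
Local Open Scope ring_scope.

Section gaussian.
Context {R : realType}.

Definition Phi (x : R) : R := fine (normal_prob 0 1 `]-oo, x]).

(* Phi is an increasing bijection from R onto ]0, 1[: for 0 < p < 1 the set
   below is a singleton; the value 0 is junk for the other p. *)
Definition Phi_inv (p : R) : R := xget 0 [set x | Phi x = p].

(* [N(0, sigma^2)]: the second parameter of normal_prob is the standard
   deviation. *)
Definition gaussian_noise (K : choiceType) d (T : measurableType d)
    (P : probability T R) (sigma : R) (U : {fset K})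
    (Z : K -> {RV P >-> R}) : Prop :=
  (forall i, i \in U -> forall B : set R, measurable B ->
     distribution P (Z i) B = normal_prob 0 sigma B) /\
  (forall J : {fset K}, {subset J <= U} -> forall B : K -> set R,
     (forall j, j \in J -> measurable (B j)) ->
     P (\bigcap_(j in [set` J]) Z j @^-1` B j) =
     (\prod_(j <- J) P (Z j @^-1` B j))%E).

End gaussian.

Section weight_and_threshold.
Context {R : realType}.

Definition calibrated (eps delta sigma : R) : Prop :=
  Phi ((2 * sigma)^-1 - eps * sigma)
    - expR eps * Phi (- (2 * sigma)^-1 - eps * sigma) <= delta / 2.

Definition rho_term (delta sigma : R) (t : nat) : R :=
  (Num.sqrt t%:R)^-1 + sigma * Phi_inv ((1 - delta / 2) `^ (t%:R^-1)).

(* The default value of the maximum is its t = 1 term, so that for Delta0 > 0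
   this is the maximum over t in {1, ..., Delta0}. *)
Definition rho (delta sigma : R) (Delta0 : nat) : R :=
  \big[Num.max/rho_term delta sigma 1]_(1 <= t < Delta0.+1)
     rho_term delta sigma t.

Definition noisy_output (K : choiceType) (T : Type) (U : {fset K})
    (w : K -> R) (Z : K -> T -> R) (thr : R) (x : T) : {fset K} :=
  [fset i in U | (thr <= w i + Z i x)%R]%fset.

End weight_and_threshold.

Section weightings.
Context {R : realType} {K : choiceType} {n : nat}.
Variable S : 'I_n -> {fset K}.

Definition items : {fset K} := (\bigcup_(u <- enum 'I_n) S u)%fset.

Definition deg (u : 'I_n) : R := (#|` S u|)%:R.

Definition basic_weight (i : K) : R :=
  \sum_(u < n | i \in S u) (Num.sqrt (deg u))^-1.

Section mad.
Variables tau dmax : R.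

Definition mad_alpha : R := 1 - (2 * Num.sqrt dmax)^-1.

Definition adaptive (u : 'I_n) : bool := 1 <= deg u <= dmax.

Definition w_init (i : K) : R :=
  \sum_(u < n | adaptive u && (i \in S u)) (deg u)^-1.

Definition excess_ratio (i : K) : R :=
  if w_init i == 0 then 0 else Num.max 0 ((w_init i - tau) / w_init i).

Definition w_trunc (i : K) : R := Num.min (w_init i) tau.

Definition user_excess (u : 'I_n) : R :=
  (deg u)^-1 * \sum_(i <- S u) excess_ratio i.

Definition w_reroute (i : K) : R :=
  \sum_(u < n | adaptive u && (i \in S u)) mad_alpha * user_excess u / dmax.

Definition mad_weight (i : K) : R :=
  w_trunc i + w_reroute i
  + \sum_(u < n | adaptive u && (i \in S u))
      ((Num.sqrt (deg u))^-1 - (deg u)^-1)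
  + \sum_(u < n | ~~ adaptive u && (i \in S u)) (Num.sqrt (deg u))^-1.

End mad.

End weightings.

(* Main.v *)
Require Import Defs.
From HB Require Import structures.
From mathcomp Require Import all_boot all_order all_algebra finmap.
From mathcomp Require Import all_classical all_reals all_analysis.
From mathcomp Require Import ring lra.

Set Implicit Arguments.
Unset Strict Implicit.
Unset Printing Implicit Defensive.

Import Order.TTheory GRing.Theory Num.Theory.
Import numFieldNormedType.Exports.

Local Open Scope classical_set_scope.
Local Open Scope ring_scope.

(** Let [w] and [w'] be the two weights of an item. If its initial weight is at
    most [tau], nothing is truncated, and [w'] exceeds [w] by the nonnegative
    rerouted weight. Otherwise the truncated part alone contributes
    [tau = rho + beta * sigma] and all other parts of [w'] are nonnegative, so
    the item survives as soon as its noise is at least [- beta * sigma], an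
    event of probability [Phi beta] by symmetry of the Gaussian. *)

(** The density is even, so the sign in [- s^-1 * x] is free; it is chosen to fit the decreasing
    substitution of the next lemma. *)
Lemma normal_pdf_scale (R : realType) (s x : R) : 0 < s ->
  normal_pdf 0 s x = normal_pdf 0 1 (- s^-1 * x) * s^-1.
Proof.
move=> s0; have s_neq0 : s != 0 by rewrite gt_eqF.
rewrite !normal_pdfE ?oner_eq0// [RHS]mulrAC /normal_peak /normal_fun.
congr (_ * _).
  rewrite -mulrnAr sqrtrM ?sqr_ge0// sqrtr_sqr (gtr0_norm s0) expr1n mul1r.
  by rewrite invfM mulrC.
by congr expR; field.
Qed.

(** Reflection and rescaling are done in one change of variables: [y |-> - s^-1 * y] is decreasing
    and sends the upper half-line onto the lower one that defines [Phi x]. *)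
Lemma normal_prob_upper_tail (R : realType) (s x : R) : 0 < s ->
  normal_prob 0 s `[- (x * s), +oo[ = (Phi x)%:E.
Proof.
move=> s0; have s_neq0 : s != 0 by rewrite gt_eqF.
rewrite /Phi fineK; last exact: fin_num_measure.
(* Exhibits [x] as the image of the left endpoint; the next rewrite restores that endpoint, which
   this one also expands. *)
have -> : x = - s^-1 * (- (x * s)) by field.
have -> : - (- s^-1 * - (x * s) * s) = - (x * s) by field.
set a := - (x * s).
pose F (y : R) : R := - s^-1 * y.
have F'E : F^`()%classic = cst (- s^-1).
  apply/funext => y; rewrite /F derive1E deriveM// derive_cst scaler0 addr0.
  by rewrite derive_id scaler1.
have Flim : F y @[y --> +oo] --> -oo.
  have -> : F = - (fun y => s^-1 * y) by apply/funext => y; rewrite /F mulNr.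
  by apply/cvgNrNy; apply: gt0_cvgMry; rewrite ?invr_gt0.
rewrite /normal_prob (_ : - s^-1 * a = F a)//.
rewrite (@decreasing_ge0_integration_by_substitutiony _ F)//.
(* The Jacobian factor is minus the derivative of [F], that is [s^-1]. *)
- apply: eq_integral => y _; rewrite F'E !fctE /=.
  by rewrite (normal_pdf_scale _ s0) opprK.
- by move=> y z _ _ yz; rewrite /F ltr_nM2l// oppr_lt0 invr_gt0.
- by rewrite F'E => ? _; exact: cvg_cst.
- by rewrite F'E; exact: is_cvg_cst.
- by rewrite F'E; exact: is_cvg_cst.
- split; last first.
    by apply: cvg_at_right_filter; exact: mulrl_continuous.
  by move=> y _; exact: derivableM.
- by apply: continuous_subspaceT; apply: continuous_normal_pdf; rewrite oner_eq0.
- by move=> y _; exact: normal_pdf_ge0.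
Qed.

Section mad_bounds.
Context {R : realType} {K : choiceType} {n : nat}.
Variables (S : 'I_n -> {fset K}) (tau dmax : R).
Hypothesis dmax_ge1 : 1 <= dmax.

Lemma mad_alpha_ge0 : 0 <= mad_alpha dmax.
Proof.
have s1 : 1 <= Num.sqrt dmax.
  by rewrite -[leLHS]sqrtr1 ler_sqrt// (le_trans ler01).
by rewrite subr_ge0 invf_le1; lra.
Qed.

Lemma excess_ratio_ge0 i : 0 <= excess_ratio S tau dmax i.
Proof. by rewrite /excess_ratio; case: ifP => // _; rewrite le_max lexx. Qed.

Lemma w_reroute_ge0 i : 0 <= w_reroute S tau dmax i.
Proof.
have dmax_ge0 : 0 <= dmax by exact: le_trans ler01 dmax_ge1.
apply: sumr_ge0 => u _; rewrite divr_ge0// mulr_ge0 ?mad_alpha_ge0//.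
rewrite /user_excess mulr_ge0 ?invr_ge0 ?ler0n// sumr_ge0// => j _.
exact: excess_ratio_ge0.
Qed.

(** Written in the shape of [mad_weight], so that the two weights differ only in [w_init] against
    [w_trunc + w_reroute]. *)
Lemma basic_weightE i : basic_weight S i =
  w_init S dmax i
  + \sum_(u < n | adaptive S dmax u && (i \in S u))
      ((Num.sqrt (deg S u))^-1 - (deg S u)^-1)
  + \sum_(u < n | ~~ adaptive S dmax u && (i \in S u)) (Num.sqrt (deg S u))^-1.
Proof.
rewrite /basic_weight (bigID (adaptive S dmax)) /=; congr (_ + _).
  rewrite -big_split /=; apply: eq_big => u; first by rewrite andbC.
  by move=> _; rewrite addrC subrK.
by apply: eq_bigl => u; rewrite andbC.
Qed.

Lemma mad_weight_ge_basic i : w_init S dmax i <= tau ->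
  basic_weight S i <= mad_weight S tau dmax i.
Proof.
move=> le_tau; rewrite basic_weightE /mad_weight /w_trunc (min_idPl le_tau).
by rewrite !lerD2r lerDl w_reroute_ge0.
Qed.

Lemma mad_weight_ge_tau i : tau <= w_init S dmax i ->
  tau <= mad_weight S tau dmax i.
Proof.
move=> tau_le; rewrite /mad_weight /w_trunc (min_idPr tau_le) -!addrA lerDl.
rewrite addr_ge0 ?w_reroute_ge0// addr_ge0//; apply: sumr_ge0 => u; last first.
  by move=> _; rewrite invr_ge0 sqrtr_ge0.
(* An adaptive user has degree at least 1, hence the square root of the degree is at most the degree
   and the correction term is nonnegative. *)
case/andP => /andP[deg1 _] _; have deg0 := lt_le_trans ltr01 deg1.
rewrite subr_ge0 lef_pV2 ?posrE ?sqrtr_gt0//.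
rewrite -[leRHS](sqr_sqrtr (ltW deg0)) expr2 ler_peMr ?sqrtr_ge0//.
by rewrite -[leLHS]sqrtr1 ler_sqrt.
Qed.

End mad_bounds.

(** An item of [U] is output exactly when its own noise reaches [thr - w i], so the marginal law of
    [Z i] gives the probability. *)
Lemma prob_noisy_output (R : realType) (K : choiceType) (d : measure_display)
    (T : measurableType d) (P : probability T R) (sigma : R) (U : {fset K})
    (Z : K -> {RV P >-> R}) (w : K -> R) (thr : R) (i : K) :
  gaussian_noise sigma U Z -> i \in U ->
  P [set x | i \in noisy_output U w Z thr x] =
  normal_prob 0 sigma `[thr - w i, +oo[.
Proof.
move=> [distrZ _] iU; rewrite -(distrZ i iU)//; congr (P _).
by apply/seteqP; split => x /=; rewrite in_itv /= !inE iU andbT lerBlDl.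
Qed.

(** Turns comparisons of weights into comparisons of probabilities: a larger weight lowers the
    cut-off [thr - w i]. *)
Lemma normal_prob_upper_tail_le (R : realType) (s a b : R) : b <= a ->
  (normal_prob 0 s `[a, +oo[ <= normal_prob 0 s `[b, +oo[)%E.
Proof.
move=> ba; apply: le_measure; rewrite ?inE//.
by apply: subset_itvr; rewrite bnd_simp.
Qed.

Theorem theorem18 (R : realType) (eps delta beta dmax sigma : R) (Delta0 : nat)
  (K : choiceType) (n : nat) (S : 'I_n -> {fset K})
  (d d' : measure_display) (T : measurableType d) (T' : measurableType d')
  (P : probability T R) (P' : probability T' R)
  (Z : K -> {RV P >-> R}) (Z' : K -> {RV P' >-> R})
  (heps : 0 < eps) (hdelta : 0 < delta < 1) (hDelta0 : (0 < Delta0)%N)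
  (hbeta : 0 <= beta) (hdmax : 1 < dmax <= Delta0%:R)
  (hS : forall u : 'I_n, (#|` S u| <= Delta0)%N)
  (hsigma : 0 < sigma) (hcal : calibrated eps delta sigma)
  (hZ : gaussian_noise sigma (items S) Z)
  (hZ' : gaussian_noise sigma (items S) Z') :
  let thr := rho delta sigma Delta0 in
  let tau := thr + beta * sigma in
  let U := noisy_output (items S) (basic_weight S) Z thr in
  let U' := noisy_output (items S) (mad_weight S tau dmax) Z' thr in
  forall i : K, i \in items S ->
    ((P [set x | i \in U x] < (Phi beta)%:E)%E ->
       (P [set x | i \in U x] <= P' [set x | i \in U' x])%E) /\
    (((Phi beta)%:E <= P [set x | i \in U x])%E ->
       ((Phi beta)%:E <= P' [set x | i \in U' x])%E).
Proof.
move=> thr tau U U' i iS.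
have dmax_ge1 : 1 <= dmax by case/andP: hdmax => /ltW.
rewrite (prob_noisy_output _ _ hZ iS) (prob_noisy_output _ _ hZ' iS).
(* The split is on the initial weight, not on the probability: each branch proves one bound that
   yields both implications. *)
have [le_tau|/ltW tau_le] := leP (w_init S dmax i) tau.
  have le_prob : (normal_prob 0 sigma `[(thr - basic_weight S i)%R, +oo[ <=
      normal_prob 0 sigma `[(thr - mad_weight S tau dmax i)%R, +oo[)%E.
    by apply: normal_prob_upper_tail_le; rewrite lerB// mad_weight_ge_basic.
  by split=> // Phi_le; exact: le_trans Phi_le le_prob.
have Phi_le : ((Phi beta)%:E <=
    normal_prob 0 sigma `[(thr - mad_weight S tau dmax i)%R, +oo[)%E.
  rewrite -(normal_prob_upper_tail beta hsigma); apply: normal_prob_upper_tail_le.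
  (* The cut-off is at most [- (beta * sigma)] precisely when the weight is at least [tau]. *)
  by rewrite lerBlDr addrC -lerBlDr opprK; exact: mad_weight_ge_tau.
by split=> // /ltW lt_Phi; exact: le_trans lt_Phi Phi_le.
Qed.
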